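(* Let $\mathcal C$ be a semi-abelian category. The following are equivalent: (i) the only abelian object of $\mathcal C$ is the zero object; (ii) for every object $A$ and subobjects $X,Y\le A$, the Higgins commutator satisfies $[X,Y]=X^{Y}\wedge Y^{X}$; (iii) every object $A$ of $\mathcal C$ is perfect, i.e. $[A,A]=A$.
   Context: Semi-abelian category: pointed, Barr-exact, protomodular, with binary coproducts. For objects $X,Y$, the cosmash product $X\diamond Y$ is the kernel of $\Sigma_{X,Y}=\bigl(\begin{smallmatrix}1_X&0\\0&1_Y\end{smallmatrix}\bigr)\colon X+Y\to X\times Y$; for subobjects $x\colon X\rightarrowtail A$, $y\colon Y\rightarrowtail A$, the Higgins commutator $[X,Y]$ is the regular image of $X\diamond Y$ under $\langle x,y\rangle\colon X+Y\to A$. For subobjects $X,Y\le A$, $Y^X$ denotes the normal closure of $Y$ in the join $X\vee Y$ (smallest normal subobject of $X\vee Y$ containing $Y$), and $X^Y$ symmetrically; $\wedge$ is intersection of subobjects. An object $A$ is abelian if $A$ Huq-commutes with itself, i.e. there is $\varphi\colon A\times A\to A$ with $\varphi(1_A,0)=1_A=\varphi(0,1_A)$ (equivalently $[A,A]=0$). *)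

(* Defs.v *)
Record Cat := {
  ob :> Type;
  hom : ob -> ob -> Type;
  comp : forall x y z : ob, hom y z -> hom x y -> hom x z;
  idm : forall a : ob, hom a a;
  comp_assoc : forall a b c d (h : hom c d) (g : hom b c) (f : hom a b),
      comp a c d h (comp a b c g f) = comp a b d (comp b c d h g) f;
  comp_idl : forall a b (f : hom a b), comp a b b (idm b) f = f;
  comp_idr : forall a b (f : hom a b), comp a a b f (idm a) = f
}.

Arguments hom {c} _ _ : rename.
Arguments comp {c x y z} _ _ : rename.
Arguments idm {c} _ : rename.

Notation "g ∘ f" := (comp g f) (at level 40, left associativity).

Section Notions.
Variable C : Cat.

Definition is_mono {X Y : C} (f : hom X Y) : Prop :=
  forall Z (g h : hom Z X), f ∘ g = f ∘ h -> g = h.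

Definition is_iso {X Y : C} (f : hom X Y) : Prop :=
  exists g : hom Y X, g ∘ f = idm X /\ f ∘ g = idm Y.

Definition is_initial (I : C) : Prop :=
  forall X : C, exists f : hom I X, forall g : hom I X, g = f.
Definition is_terminal (T : C) : Prop :=
  forall X : C, exists f : hom X T, forall g : hom X T, g = f.
Definition is_zero_obj (Z : C) : Prop := is_initial Z /\ is_terminal Z.

Definition pointed : Prop := exists Z : C, is_zero_obj Z.

Definition is_zero_map {X Y : C} (f : hom X Y) : Prop :=
  exists (Z : C) (g : hom X Z) (h : hom Z Y), is_zero_obj Z /\ f = h ∘ g.

Definition is_pullback {A B D P : C} (f : hom A D) (g : hom B D)
    (p1 : hom P A) (p2 : hom P B) : Prop :=
  f ∘ p1 = g ∘ p2 /\
  forall Q (q1 : hom Q A) (q2 : hom Q B), f ∘ q1 = g ∘ q2 ->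
    exists! u : hom Q P, p1 ∘ u = q1 /\ p2 ∘ u = q2.

Definition has_pullbacks : Prop :=
  forall (A B D : C) (f : hom A D) (g : hom B D),
    exists (P : C) (p1 : hom P A) (p2 : hom P B), is_pullback f g p1 p2.

Definition has_finite_limits : Prop :=
  (exists T : C, is_terminal T) /\ has_pullbacks.

Definition is_product {X Y P : C} (p1 : hom P X) (p2 : hom P Y) : Prop :=
  forall Q (q1 : hom Q X) (q2 : hom Q Y),
    exists! u : hom Q P, p1 ∘ u = q1 /\ p2 ∘ u = q2.

Definition is_coproduct {X Y S : C} (i1 : hom X S) (i2 : hom Y S) : Prop :=
  forall Q (q1 : hom X Q) (q2 : hom Y Q),
    exists! u : hom S Q, u ∘ i1 = q1 /\ u ∘ i2 = q2.

Definition has_binary_coproducts : Prop :=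
  forall X Y : C, exists (S : C) (i1 : hom X S) (i2 : hom Y S), is_coproduct i1 i2.

Definition is_coequalizer {A B Q : C} (f g : hom A B) (q : hom B Q) : Prop :=
  q ∘ f = q ∘ g /\
  forall Z (h : hom B Z), h ∘ f = h ∘ g -> exists! u : hom Q Z, u ∘ q = h.

Definition is_regular_epi {B Q : C} (q : hom B Q) : Prop :=
  exists (A : C) (f g : hom A B), is_coequalizer f g q.

Definition is_kernel_pair {R X Y : C} (f : hom X Y) (r1 r2 : hom R X) : Prop :=
  is_pullback f f r1 r2.

Definition is_kernel {K A B : C} (f : hom A B) (k : hom K A) : Prop :=
  is_zero_map (f ∘ k) /\
  forall Z (h : hom Z A), is_zero_map (f ∘ h) -> exists! u : hom Z K, k ∘ u = h.

Definition regular : Prop :=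
  has_finite_limits /\
  (forall (R X Y : C) (f : hom X Y) (r1 r2 : hom R X), is_kernel_pair f r1 r2 ->
     exists (Q : C) (q : hom X Q), is_coequalizer r1 r2 q) /\
  (forall (A B D P : C) (f : hom A D) (g : hom B D) (p1 : hom P A) (p2 : hom P B),
     is_pullback f g p1 p2 -> is_regular_epi g -> is_regular_epi p1).

Definition is_equivalence_relation {R X : C} (r1 r2 : hom R X) : Prop :=
  (forall Z (a b : hom Z R), r1 ∘ a = r1 ∘ b -> r2 ∘ a = r2 ∘ b -> a = b) /\
  (exists d : hom X R, r1 ∘ d = idm X /\ r2 ∘ d = idm X) /\
  (exists s : hom R R, r1 ∘ s = r2 /\ r2 ∘ s = r1) /\
  (forall (P : C) (p1 p2 : hom P R), is_pullback r2 r1 p1 p2 ->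
     exists t : hom P R, r1 ∘ t = r1 ∘ p1 /\ r2 ∘ t = r2 ∘ p2).

Definition barr_exact : Prop :=
  regular /\
  forall (R X : C) (r1 r2 : hom R X), is_equivalence_relation r1 r2 ->
    exists (Y : C) (f : hom X Y), is_kernel_pair f r1 r2.

(** Protomodularity, in the pointed finitely complete setting:
    the split short five lemma. *)
Definition split_short_five : Prop :=
  forall (A B A' B' K K' : C) (p : hom A B) (s : hom B A) (p' : hom A' B')
         (s' : hom B' A') (k : hom K A) (k' : hom K' A')
         (u : hom K K') (v : hom A A') (w : hom B B'),
    p ∘ s = idm B -> p' ∘ s' = idm B' ->
    is_kernel p k -> is_kernel p' k' ->
    v ∘ k = k' ∘ u -> p' ∘ v = w ∘ p -> v ∘ s = s' ∘ w ->
    is_iso u -> is_iso w -> is_iso v.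

Definition semi_abelian : Prop :=
  pointed /\ has_finite_limits /\ barr_exact /\ split_short_five /\
  has_binary_coproducts.

Record subobj (A : C) := Subobj { sob : C; sarr : hom sob A }.
Arguments Subobj {A sob} sarr.
Arguments sob {A} _.
Arguments sarr {A} _.

Definition is_subobj {A : C} (X : subobj A) : Prop := is_mono (sarr X).

Definition sub_le {A : C} (X Y : subobj A) : Prop :=
  exists u : hom (sob X) (sob Y), sarr Y ∘ u = sarr X.

Definition sub_eq {A : C} (X Y : subobj A) : Prop := sub_le X Y /\ sub_le Y X.

Definition top_sub (A : C) : subobj A := Subobj (idm A).

Definition push_sub {A : C} (J : subobj A) (N : subobj (sob J)) : subobj A :=
  Subobj (sarr J ∘ sarr N).

Definition is_join {A : C} (X Y J : subobj A) : Prop :=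
  is_subobj J /\ sub_le X J /\ sub_le Y J /\
  forall W : subobj A, is_subobj W -> sub_le X W -> sub_le Y W -> sub_le J W.

Definition is_meet {A : C} (X Y M : subobj A) : Prop :=
  is_subobj M /\ sub_le M X /\ sub_le M Y /\
  forall W : subobj A, is_subobj W -> sub_le W X -> sub_le W Y -> sub_le W M.

Definition is_normal {B : C} (N : subobj B) : Prop :=
  exists (D : C) (f : hom B D), is_kernel f (sarr N).

Definition is_normal_closure {A : C} (J Y : subobj A) (N : subobj (sob J)) : Prop :=
  is_subobj N /\ is_normal N /\ sub_le Y (push_sub J N) /\
  forall N' : subobj (sob J), is_subobj N' -> is_normal N' ->
    sub_le Y (push_sub J N') -> sub_le N N'.

Definition is_regular_image {Z A : C} (f : hom Z A) (I : subobj A) : Prop :=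
  is_subobj I /\ exists e : hom Z (sob I), is_regular_epi e /\ sarr I ∘ e = f.

(** Higgins commutator [X,Y]: regular image of the cosmash product
    X ⋄ Y = ker (Σ_{X,Y} : X+Y -> X×Y) under <x,y> : X+Y -> A. *)
Definition is_higgins_commutator {A : C} (X Y H : subobj A) : Prop :=
  exists (S : C) (i1 : hom (sob X) S) (i2 : hom (sob Y) S)
         (P : C) (p1 : hom P (sob X)) (p2 : hom P (sob Y))
         (Sigma : hom S P) (K : C) (k : hom K S) (c : hom S A),
    is_coproduct i1 i2 /\ is_product p1 p2 /\
    p1 ∘ (Sigma ∘ i1) = idm (sob X) /\ is_zero_map (p2 ∘ (Sigma ∘ i1)) /\
    is_zero_map (p1 ∘ (Sigma ∘ i2)) /\ p2 ∘ (Sigma ∘ i2) = idm (sob Y) /\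
    is_kernel Sigma k /\
    c ∘ i1 = sarr X /\ c ∘ i2 = sarr Y /\
    is_regular_image (c ∘ k) H.

(** Abelian objects: A Huq-commutes with itself. *)
Definition is_abelian_obj (A : C) : Prop :=
  exists (P : C) (p1 p2 : hom P A) (phi : hom P A) (e1 e2 : hom A P),
    is_product p1 p2 /\
    p1 ∘ e1 = idm A /\ is_zero_map (p2 ∘ e1) /\
    is_zero_map (p1 ∘ e2) /\ p2 ∘ e2 = idm A /\
    phi ∘ e1 = idm A /\ phi ∘ e2 = idm A.

Definition only_abelian_is_zero : Prop :=
  forall A : C, is_abelian_obj A -> is_zero_obj A.

Definition higgins_is_meet_of_normal_closures : Prop :=
  forall (A : C) (X Y : subobj A), is_subobj X -> is_subobj Y ->
  forall (J : subobj A) (NX NY : subobj (sob J)) (M H : subobj A),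
    is_join X Y J ->
    is_normal_closure J X NX ->
    is_normal_closure J Y NY ->
    is_meet (push_sub J NX) (push_sub J NY) M ->
    is_higgins_commutator X Y H ->
    sub_eq H M.

Definition all_perfect : Prop :=
  forall (A : C) (H : subobj A),
    is_higgins_commutator (top_sub A) (top_sub A) H -> sub_eq H (top_sub A).

End Notions.

(* Main.v *)
From Corelib Require Import ssreflect.
Require Import Defs.

(** Call two maps commuting if they extend along the two injections to the
    product of their domains.  Along a regular epimorphism X + Y -> J the
    cosmash product has a normal image, which is [X,Y]; in J/[X,Y] the images of
    X and Y commute, because X + Y -> X x Y is the cokernel of the cosmash product.
    With X = Y = A this makes A/[A,A] abelian, so (i) gives [A,A] = A.  For J the
    join of X and Y, the induced map X x Y -> J/[X,Y] is a regular epimorphism, so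
    the images of X and Y are normal and contain those of X^Y and Y^X; hence the
    map from the meet of X^Y and Y^X to J/[X,Y] commutes with itself.  A map with
    perfect domain commuting with itself is zero, so that meet lies in [X,Y].

    Protomodularity enters through one fact: a monomorphism into D through which
    the kernel and the section of a split epimorphism on D factor is invertible. *)

Section SemiAbelian.
#[local] Arguments Subobj {C A sob} sarr.
#[local] Arguments sob {C A} _.
#[local] Arguments sarr {C A} _.
Context {C : Cat}.

(** * Composites, zero maps and universal properties *)

Lemma precomp {X Y Z : C} {f : hom Y Z} {g : hom X Y} {h : hom X Z} :
  f ∘ g = h -> forall (W : C) (x : hom W X), f ∘ (g ∘ x) = h ∘ x.
Proof. by move=> E W x; rewrite comp_assoc E. Qed.

Lemma precomp_square {X Y Y' Z : C} {f : hom Y Z} {g : hom X Y}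
    {h : hom Y' Z} {k : hom X Y'} :
  f ∘ g = h ∘ k -> forall (W : C) (x : hom W X), f ∘ (g ∘ x) = h ∘ (k ∘ x).
Proof. by move=> E W x; rewrite !comp_assoc E. Qed.

Ltac assoc := rewrite -?comp_assoc ?comp_idl ?comp_idr.
(** Lets an equation between composites act inside a longer composite associated to the right;
    [precomp] covers the case of a further map applied first. *)
Ltac chain E :=
  rewrite -?comp_assoc; first [rewrite (precomp E) | rewrite E]; assoc.

Definition is_epi {X Y : C} (f : hom X Y) : Prop :=
  forall Z (g h : hom Y Z), g ∘ f = h ∘ f -> g = h.

Lemma zero_map_comp_l {X Y Z : C} (g : hom Y Z) (f : hom X Y) :
  is_zero_map C f -> is_zero_map C (g ∘ f).
Proof.
move=> [O [a [b [HO ->]]]]; exists O, a, (g ∘ b); split => //.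
by rewrite comp_assoc.
Qed.

Lemma zero_map_comp_r {X Y Z : C} (g : hom Y Z) (f : hom X Y) :
  is_zero_map C g -> is_zero_map C (g ∘ f).
Proof.
move=> [O [a [b [HO ->]]]]; exists O, (a ∘ f), b; split => //.
by rewrite comp_assoc.
Qed.

Lemma zero_map_unique {X Y : C} (f g : hom X Y) :
  is_zero_map C f -> is_zero_map C g -> f = g.
Proof.
move=> [O [a [b [[Oi Ot] ->]]]] [O' [a' [b' [[Oi' Ot'] ->]]]].
have [u _] := Oi O'.
have -> : b = b' ∘ u by have [v Ev] := Oi Y; rewrite (Ev b) (Ev (b' ∘ u)).
have -> : a' = u ∘ a by have [v Ev] := Ot' X; rewrite (Ev a') (Ev (u ∘ a)).
by rewrite comp_assoc.
Qed.

Lemma epi_zero_map {X Y Z : C} (f : hom Y Z) (e : hom X Y) :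
  pointed C -> is_epi e -> is_zero_map C (f ∘ e) -> is_zero_map C f.
Proof.
move=> [O HO] He Hf.
have [a _] := proj2 HO Y; have [b _] := proj1 HO Z.
have Hz : is_zero_map C (b ∘ a) by exists O, a, b.
suff -> : f = b ∘ a by [].
by apply: He; apply: zero_map_unique => //; apply: zero_map_comp_r.
Qed.

Lemma zero_id_zero_obj (A : C) : is_zero_map C (idm A) -> is_zero_obj C A.
Proof.
move=> [O [a [b [[Oi Ot] E]]]]; split=> X.
- have [v Ev] := Oi X; exists (v ∘ a) => g.
  by rewrite -(comp_idr _ _ _ g) E comp_assoc (Ev (g ∘ b)).
- have [v Ev] := Ot X; exists (b ∘ v) => g.
  by rewrite -(comp_idl _ _ _ g) E -comp_assoc (Ev (a ∘ g)).
Qed.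

Lemma zero_obj_zero_map {A B D : C} (f : hom A B) :
  is_zero_obj C B -> is_zero_map C f.
Proof. by move=> HB; exists B, f, (idm B); rewrite comp_idl. Qed.

Lemma kernel_mono {K A B : C} (f : hom A B) (k : hom K A) :
  is_kernel C f k -> is_mono C k.
Proof.
move=> [Hz Hu] Z g h E.
have [|u [_ Eu]] := Hu Z (k ∘ g).
  by rewrite comp_assoc; apply: zero_map_comp_r.
by rewrite -(Eu g eq_refl) -(Eu h (eq_sym E)).
Qed.

Lemma product_ext {X Y P Q : C} (p1 : hom P X) (p2 : hom P Y) (u v : hom Q P) :
  is_product C p1 p2 -> p1 ∘ u = p1 ∘ v -> p2 ∘ u = p2 ∘ v -> u = v.
Proof.
move=> HP E1 E2; have [w [_ Ew]] := HP Q (p1 ∘ v) (p2 ∘ v).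
by rewrite -(Ew u (conj E1 E2)) (Ew v (conj eq_refl eq_refl)).
Qed.

Lemma coproduct_ext {X Y S Q : C} (i1 : hom X S) (i2 : hom Y S) (u v : hom S Q) :
  is_coproduct C i1 i2 -> u ∘ i1 = v ∘ i1 -> u ∘ i2 = v ∘ i2 -> u = v.
Proof.
move=> HS E1 E2; have [w [_ Ew]] := HS Q (v ∘ i1) (v ∘ i2).
by rewrite -(Ew u (conj E1 E2)) (Ew v (conj eq_refl eq_refl)).
Qed.

Lemma pullback_ext {A B D P Q : C} (f : hom A D) (g : hom B D)
    (p1 : hom P A) (p2 : hom P B) (u v : hom Q P) :
  is_pullback C f g p1 p2 -> p1 ∘ u = p1 ∘ v -> p2 ∘ u = p2 ∘ v -> u = v.
Proof.
move=> [Hc HP] E1 E2; have [|w [_ Ew]] := HP Q (p1 ∘ v) (p2 ∘ v).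
  by rewrite !comp_assoc Hc.
by rewrite -(Ew u (conj E1 E2)) (Ew v (conj eq_refl eq_refl)).
Qed.

Lemma regular_epi_epi {X Y : C} (q : hom X Y) : is_regular_epi C q -> is_epi q.
Proof.
move=> [A [f [g [Hc Hu]]]] Z a b E.
have [|w [_ Ew]] := Hu Z (b ∘ q); first by rewrite -!comp_assoc Hc.
by rewrite -(Ew a E) (Ew b eq_refl).
Qed.

Lemma regular_epi_factor {X Y Z : C} (q : hom X Y) (h : hom X Z) :
  is_regular_epi C q ->
  (forall T (a b : hom T X), q ∘ a = q ∘ b -> h ∘ a = h ∘ b) ->
  exists u : hom Y Z, u ∘ q = h.
Proof.
move=> [A [f [g [Hc Hu]]]] Hh.
by have [u [Eu _]] := Hu Z h (Hh _ _ _ Hc); exists u.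
Qed.

(** Diagonal fill-in: as [m] is monic, [x] identifies whatever [e] identifies and so descends along
    [e]. *)
Lemma regular_epi_strong {X Y A B : C} (e : hom X Y) (m : hom A B)
    (x : hom X A) (y : hom Y B) :
  is_regular_epi C e -> is_mono C m -> m ∘ x = y ∘ e ->
  exists z : hom Y A, m ∘ z = y.
Proof.
move=> He Hm E.
have [|z Ez] := regular_epi_factor e x He.
  by move=> T a b Eab; apply: Hm; rewrite !(precomp E) -!comp_assoc Eab.
exists z; apply: (regular_epi_epi _ He).
by rewrite -comp_assoc Ez.
Qed.

(** * Products with their injections, and commuting maps *)

Definition is_product_inj {X Y P : C} (p1 : hom P X) (p2 : hom P Y)
    (e1 : hom X P) (e2 : hom Y P) : Prop :=
  is_product C p1 p2 /\
  p1 ∘ e1 = idm X /\ is_zero_map C (p2 ∘ e1) /\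
  is_zero_map C (p1 ∘ e2) /\ p2 ∘ e2 = idm Y.

Lemma product_inj_sym {X Y P : C} (p1 : hom P X) (p2 : hom P Y)
    (e1 : hom X P) (e2 : hom Y P) :
  is_product_inj p1 p2 e1 e2 -> is_product_inj p2 p1 e2 e1.
Proof.
move=> [HP [E11 [E21 [E12 E22]]]]; do !split => //.
move=> Q q1 q2; have [u [[E1 E2] Eu]] := HP Q q2 q1.
by exists u; split => // v [Ev1 Ev2]; apply: Eu.
Qed.

Lemma product_inj_kernel {X Y P : C} (p1 : hom P X) (p2 : hom P Y)
    (e1 : hom X P) (e2 : hom Y P) :
  is_product_inj p1 p2 e1 e2 -> is_kernel C p2 e1.
Proof.
move=> [HP [E11 [E21 [E12 E22]]]]; split => // Z h Hh.
exists (p1 ∘ h); split.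
  apply: (product_ext _ _ _ _ HP); first by chain E11.
  by apply: zero_map_unique => //; rewrite comp_assoc; apply: zero_map_comp_r.
by move=> u <-; chain E11.
Qed.

(** Commutation in the sense of Huq, with cooperator [phi]. *)
Definition commute {X Y Q : C} (f : hom X Q) (g : hom Y Q) : Prop :=
  exists (P : C) (p1 : hom P X) (p2 : hom P Y) (e1 : hom X P) (e2 : hom Y P)
         (phi : hom P Q),
    is_product_inj p1 p2 e1 e2 /\ phi ∘ e1 = f /\ phi ∘ e2 = g.

Lemma commute_sym {X Y Q : C} (f : hom X Q) (g : hom Y Q) :
  commute f g -> commute g f.
Proof.
move=> [P [p1 [p2 [e1 [e2 [phi [HP [E1 E2]]]]]]]].
by exists P, p2, p1, e2, e1, phi; split => //; apply: product_inj_sym.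
Qed.

Lemma commute_id_abelian (A : C) :
  commute (idm A) (idm A) <-> is_abelian_obj C A.
Proof.
split.
- move=> [P [p1 [p2 [e1 [e2 [phi [[HP [E1 [E2 [E3 E4]]]] [E5 E6]]]]]]]].
  by exists P, p1, p2, phi, e1, e2.
- move=> [P [p1 [p2 [phi [e1 [e2 [HP [E1 [E2 [E3 [E4 [E5 E6]]]]]]]]]]]].
  by exists P, p1, p2, e1, e2, phi.
Qed.

(** * Limits and images in a semi-abelian category *)

Context (HC : semi_abelian C).

Lemma semi_abelian_pointed : pointed C.
Proof. by case: HC. Qed.

Lemma semi_abelian_pullbacks : has_pullbacks C.
Proof. by case: HC => _ [[_ H] _]. Qed.

Lemma zero_map_exists (X Y : C) : exists z : hom X Y, is_zero_map C z.
Proof.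
have [O HO] := semi_abelian_pointed.
have [a _] := proj2 HO X; have [b _] := proj1 HO Y.
by exists (b ∘ a), O, a, b.
Qed.

Lemma products_exist (X Y : C) :
  exists (P : C) (p1 : hom P X) (p2 : hom P Y), is_product C p1 p2.
Proof.
have [O HO] := semi_abelian_pointed.
have [a _] := proj2 HO X; have [b _] := proj2 HO Y.
have [P [p1 [p2 [_ HP]]]] := semi_abelian_pullbacks X Y O a b.
exists P, p1, p2 => Q q1 q2; apply: HP.
by have [v Ev] := proj2 HO Q; rewrite (Ev (a ∘ q1)) (Ev (b ∘ q2)).
Qed.

Lemma product_inj_exists (X Y : C) :
  exists (P : C) (p1 : hom P X) (p2 : hom P Y) (e1 : hom X P) (e2 : hom Y P),
    is_product_inj p1 p2 e1 e2.
Proof.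
have [P [p1 [p2 HP]]] := products_exist X Y.
have [z Hz] := zero_map_exists X Y; have [z' Hz'] := zero_map_exists Y X.
have [e1 [[E11 E21] _]] := HP X (idm X) z.
have [e2 [[E12 E22] _]] := HP Y z' (idm Y).
by exists P, p1, p2, e1, e2; split => //; rewrite E11 E21 E12 E22.
Qed.

Lemma kernels_exist {A B : C} (f : hom A B) :
  exists (K : C) (k : hom K A), is_kernel C f k.
Proof.
have [O HO] := semi_abelian_pointed; have [b _] := proj1 HO B.
have [K [k [o HK]]] := semi_abelian_pullbacks A O B f b.
exists K, k; split; first by exists O, o, b; split => //; case: HK.
move=> Z h Hh; have [a Ea] := proj2 HO Z.
have [|u [[E1 E2] _]] := proj2 HK Z h a.
  by apply: zero_map_unique => //; exists O, a, b.
exists u; split => // v Ev; apply: (pullback_ext _ _ _ _ _ _ HK).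
  by rewrite E1 Ev.
by rewrite E2 (Ea (o ∘ v)).
Qed.

(** The equalizer is the intersection of the graphs of [u] and [v], taken as a pullback over the
    product of [D] and [Q]. *)
Lemma equalizers_exist {D Q : C} (u v : hom D Q) :
  exists (E : C) (m : hom E D), is_mono C m /\ u ∘ m = v ∘ m /\
    forall (T : C) (x : hom T D), u ∘ x = v ∘ x -> exists y : hom T E, m ∘ y = x.
Proof.
have [P [p1 [p2 HP]]] := products_exist D Q.
have [d1 [[E11 E21] _]] := HP D (idm D) u.
have [d2 [[E12 E22] _]] := HP D (idm D) v.
have [E [m [m' HE]]] := semi_abelian_pullbacks _ _ _ d1 d2.
have Em : m = m'.
  have := f_equal (fun x => p1 ∘ x) (proj1 HE).
  by rewrite /= !comp_assoc E11 E12 !comp_idl.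
exists E, m; split; [|split].
- move=> T a b Eab; apply: (pullback_ext _ _ _ _ _ _ HE) => //.
  by rewrite -Em.
- have := f_equal (fun x => p2 ∘ x) (proj1 HE).
  by rewrite /= !comp_assoc E21 E22 Em.
- move=> T x Ex; have [|y [[Ey _] _]] := proj2 HE T x x; last by exists y.
  apply: (product_ext _ _ _ _ HP); first by chain E11; chain E12.
  by chain E21; chain E22.
Qed.

Lemma regular_epi_pullback {A B D P : C} (f : hom A D) (g : hom B D)
    (p1 : hom P A) (p2 : hom P B) :
  is_pullback C f g p1 p2 -> is_regular_epi C g -> is_regular_epi C p1.
Proof. by case: HC => _ [_ [[[_ [_ H]] _] _]]; apply: H. Qed.

(** Generalized elements of [Y] have preimages in [X] after passing to a cover [t]; arguments with
    elements below rest on this. *)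
Lemma regular_epi_lift {X Y T : C} (q : hom X Y) (a : hom T Y) :
  is_regular_epi C q ->
  exists (T' : C) (t : hom T' T) (x : hom T' X),
    is_regular_epi C t /\ q ∘ x = a ∘ t.
Proof.
move=> Hq; have [T' [t [x HP]]] := semi_abelian_pullbacks _ _ _ a q.
exists T', t, x; split; first exact: (regular_epi_pullback _ _ _ _ HP).
by case: HP.
Qed.

Lemma image_exists {X Y : C} (f : hom X Y) :
  exists (I : C) (e : hom X I) (m : hom I Y),
    is_regular_epi C e /\ is_mono C m /\ m ∘ e = f.
Proof.
have [R [r1 [r2 HR]]] := semi_abelian_pullbacks _ _ _ f f.
have [Q [q Hq]] : exists (Q : C) (q : hom X Q), is_coequalizer C r1 r2 q.
  by case: HC => _ [_ [[[_ [H _]] _] _]]; apply: H HR.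
have [m [Em _]] := proj2 Hq Y f (proj1 HR).
have Hreg : is_regular_epi C q by exists R, r1, r2.
exists Q, q, m; split => //; split => // Z a b Eab.
(* For [m] to be monic: over a common cover, [a] and [b] lift to a point of the kernel pair of [f],
   which [q] coequalizes. *)
have [Z1 [t1 [x [Ht1 Ex]]]] := regular_epi_lift q a Hreg.
have [Z2 [t2 [y [Ht2 Ey]]]] := regular_epi_lift q (b ∘ t1) Hreg.
have [|w [[E1 E2] _]] := proj2 HR Z2 (x ∘ t2) y.
  by rewrite -Em; chain Ex; chain Ey; chain Eab.
apply: (regular_epi_epi _ Ht1); apply: (regular_epi_epi _ Ht2).
by rewrite -Ey -Ex -E2 -comp_assoc -E1 !comp_assoc (proj1 Hq).
Qed.

(** A section makes the monic part of the image factorization invertible, so [f] is a coequalizer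
    because its image part is one. *)
Lemma extremal_regular_epi {X Y : C} (f : hom X Y) :
  (forall I (e : hom X I) (m : hom I Y), is_mono C m -> m ∘ e = f ->
     exists s, m ∘ s = idm Y) ->
  is_regular_epi C f.
Proof.
move=> Hf; have [I [e [m [[A [a [b [Eab He]]]] [Hm E]]]]] := image_exists f.
have [s Es] := Hf I e m Hm E.
exists A, a, b; split; first by rewrite -E -!comp_assoc Eab.
move=> Z h Eh; have [u [Eu Uu]] := He Z h Eh.
have Esm : s ∘ m = idm I by apply: Hm; chain Es.
exists (u ∘ s); split; first by rewrite -E; chain Esm.
move=> v Ev; have -> : u = v ∘ m by apply: Uu; rewrite -comp_assoc E.
by chain Es.
Qed.

(** * Consequences of protomodularity *)

Lemma split_mono_iso {E D B K : C} (m : hom E D) (p : hom D B) (s : hom B D)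
    (k : hom K D) (s' : hom B E) (k' : hom K E) :
  is_mono C m -> p ∘ s = idm B -> is_kernel C p k ->
  m ∘ s' = s -> m ∘ k' = k -> exists r, m ∘ r = idm D.
Proof.
move=> Hm Es Hk Es' Ek'.
have iso_id (X : C) : is_iso C (idm X) by exists (idm X); rewrite comp_idl.
have SS5 : split_short_five C by case: HC => _ [_ [_ [H _]]].
(* The split short five lemma compares [p ∘ m] with [p], with identities on the kernel [K] and the
   base [B]; [k'] is a kernel of [p ∘ m] since [m] is monic. *)
have [|||||||||r [_ Er]] := SS5 E B D B K K (p ∘ m) s' p s k' k (idm K) m (idm B);
  rewrite ?comp_idl ?comp_idr //.
- by chain Es'.
- split; first by chain Ek'; case: Hk.
  move=> Z h Hh; have [|u [Eu Uu]] := proj2 Hk Z (m ∘ h); first by rewrite comp_assoc.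
  by exists u; split; [apply: Hm; chain Ek' | move=> v Ev; apply: Uu; rewrite -Ev; chain Ek'].
- by exists r.
Qed.

(** The section and the kernel factor through the equalizer of [u] and [v], which is therefore all
    of [D]. *)
Lemma split_epi_jointly_epic {D B K Q : C} (p : hom D B) (s : hom B D)
    (k : hom K D) (u v : hom D Q) :
  p ∘ s = idm B -> is_kernel C p k ->
  u ∘ s = v ∘ s -> u ∘ k = v ∘ k -> u = v.
Proof.
move=> Es Hk Eus Euk.
have [E [m [Hm [Em Um]]]] := equalizers_exist u v.
have [s' Es'] := Um _ _ Eus; have [k' Ek'] := Um _ _ Euk.
have [r Er] := split_mono_iso m p s k s' k' Hm Es Hk Es' Ek'.
by rewrite -(comp_idr _ _ _ u) -(comp_idr _ _ _ v) -Er !comp_assoc Em.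
Qed.

Lemma product_inj_jointly_epic {X Y P Q : C} (p1 : hom P X) (p2 : hom P Y)
    (e1 : hom X P) (e2 : hom Y P) (u v : hom P Q) :
  is_product_inj p1 p2 e1 e2 -> u ∘ e1 = v ∘ e1 -> u ∘ e2 = v ∘ e2 -> u = v.
Proof.
move=> HP E1 E2; have Hk := product_inj_kernel _ _ _ _ HP.
have [_ [_ [_ [_ E22]]]] := HP.
exact: (split_epi_jointly_epic p2 e2 e1).
Qed.

(** * Commuting maps under composition and along regular epimorphisms *)

Lemma product_inj_pair_comp {X Y P X' Y' P' : C}
    (p1 : hom P X) (p2 : hom P Y) (e1 : hom X P) (e2 : hom Y P)
    (p1' : hom P' X') (p2' : hom P' Y') (e1' : hom X' P') (e2' : hom Y' P')
    (a : hom X X') (b : hom Y Y') :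
  is_product_inj p1 p2 e1 e2 -> is_product_inj p1' p2' e1' e2' ->
  exists u : hom P P', p1' ∘ u = a ∘ p1 /\ p2' ∘ u = b ∘ p2 /\
    u ∘ e1 = e1' ∘ a /\ u ∘ e2 = e2' ∘ b.
Proof.
move=> [HP [E11 [E21 [E12 E22]]]] [HP' [E11' [E21' [E12' E22']]]].
have [u [[E1 E2] _]] := HP' P (a ∘ p1) (b ∘ p2).
exists u; do 2!split => //; split; apply: (product_ext _ _ _ _ HP').
- by chain E1; chain E11; chain E11'.
- chain E2; apply: zero_map_unique; first exact: zero_map_comp_l.
  by rewrite comp_assoc; apply: zero_map_comp_r.
- chain E1; apply: zero_map_unique; first exact: zero_map_comp_l.
  by rewrite comp_assoc; apply: zero_map_comp_r.
- by chain E2; chain E22; chain E22'.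
Qed.

Lemma commute_comp {X Y X' Y' Q : C} (f : hom X' Q) (g : hom Y' Q)
    (a : hom X X') (b : hom Y Y') :
  commute f g -> commute (f ∘ a) (g ∘ b).
Proof.
move=> [P' [p1' [p2' [e1' [e2' [phi [HP' [E1 E2]]]]]]]].
have [P [p1 [p2 [e1 [e2 HP]]]]] := product_inj_exists X Y.
have [u [_ [_ [U1 U2]]]] :=
  product_inj_pair_comp p1 p2 e1 e2 p1' p2' e1' e2' a b HP HP'.
exists P, p1, p2, e1, e2, (phi ∘ u); split => //.
by split; [chain U1; chain E1 | chain U2; chain E2].
Qed.

(** The map e × 1 is a pullback of [e], hence a regular epimorphism, and the cooperator [phi]
    descends along it. *)
Lemma commute_regular_epi_l {X Y X' Q : C} (f : hom X' Q) (g : hom Y Q)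
    (e : hom X X') :
  is_regular_epi C e -> commute (f ∘ e) g -> commute f g.
Proof.
move=> He [P [p1 [p2 [e1 [e2 [phi [HP [E1 E2]]]]]]]].
have [P' [p1' [p2' [e1' [e2' HP']]]]] := product_inj_exists X' Y.
have [u [U1 [U2 [U3 U4]]]] :=
  product_inj_pair_comp p1 p2 e1 e2 p1' p2' e1' e2' e (idm Y) HP HP'.
move: U2 U4; rewrite comp_idl comp_idr => U2 U4.
have Hu : is_regular_epi C u.
  apply: (regular_epi_pullback p1' e u p1) => //; split => // T q1 q2 Eq.
  have [v [[V1 V2] Uv]] := proj1 HP T q2 (p2' ∘ q1).
  exists v; split.
    split => //; apply: (product_ext _ _ _ _ (proj1 HP')).
      by chain U1; rewrite V1.
    by chain U2.
  by move=> w [W1 W2]; apply: Uv; split => //; rewrite -W1; chain U2.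
have [|phi' Ephi'] := regular_epi_factor u phi Hu.
  (* Since [a] and [b] have the same second component, they are restrictions along [t] of [ua] and
     [ub] on T × Y. These agree after [phi], because they do on both injections. *)
  move=> T a b Eab.
  have [R [r1 [r2 [d1 [d2 HR]]]]] := product_inj_exists T Y.
  have [ua [UA1 [UA2 [UA3 UA4]]]] :=
    product_inj_pair_comp r1 r2 d1 d2 p1 p2 e1 e2 (p1 ∘ a) (idm Y) HR HP.
  have [ub [UB1 [UB2 [UB3 UB4]]]] :=
    product_inj_pair_comp r1 r2 d1 d2 p1 p2 e1 e2 (p1 ∘ b) (idm Y) HR HP.
  have Euab : phi ∘ ua = phi ∘ ub.
    apply: (product_inj_jointly_epic _ _ _ _ _ _ HR).
      rewrite -!comp_assoc UA3 UB3; chain E1; chain E1.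
      by rewrite -!(precomp_square U1) Eab.
    by rewrite -!comp_assoc UA4 UB4.
  have [t [[T1 T2] _]] := proj1 HR T (idm T) (p2 ∘ a).
  have Eb : p2 ∘ a = p2 ∘ b by rewrite -U2 -!comp_assoc Eab.
  have -> : a = ua ∘ t.
    apply: (product_ext _ _ _ _ (proj1 HP)).
      by chain UA1; rewrite T1; assoc.
    by chain UA2; rewrite T2.
  have -> : b = ub ∘ t.
    apply: (product_ext _ _ _ _ (proj1 HP)).
      by chain UB1; rewrite T1; assoc.
    by chain UB2; rewrite T2.
  by rewrite !comp_assoc Euab.
exists P', p1', p2', e1', e2', phi'; split => //; split.
  by apply: (regular_epi_epi _ He); rewrite -comp_assoc -U3 comp_assoc Ephi'.
by rewrite -U4 comp_assoc Ephi'.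
Qed.

Lemma commute_regular_epi {X Y X' Y' Q : C} (f : hom X' Q) (g : hom Y' Q)
    (e : hom X X') (d : hom Y Y') :
  is_regular_epi C e -> is_regular_epi C d ->
  commute (f ∘ e) (g ∘ d) -> commute f g.
Proof.
move=> He Hd /(commute_regular_epi_l _ _ _ He) /commute_sym.
by move=> /(commute_regular_epi_l _ _ _ Hd) /commute_sym.
Qed.

(** * Cokernels, direct images of relations and normal images *)

Lemma regular_epi_cokernel {X Y K Z : C} (q : hom X Y) (k : hom K X) (h : hom X Z) :
  is_regular_epi C q -> is_kernel C q k -> is_zero_map C (h ∘ k) ->
  exists u, u ∘ q = h.
Proof.
move=> Hq Hk Hh; apply: regular_epi_factor => // T a b Eab.
have [R [r1 [r2 HR]]] := semi_abelian_pullbacks _ _ _ q q.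
have [d [[D1 D2] _]] := proj2 HR X (idm X) (idm X) eq_refl.
have [L [l Hl]] := kernels_exist r2.
(* The diagonal [d] splits [r2], and [r1] sends the kernel of [r2] into that of [q], where [h]
   vanishes; so the two maps agree on a section and on a kernel. *)
have Er : h ∘ r1 = h ∘ r2.
  apply: (split_epi_jointly_epic r2 d l) => //; first by rewrite -!comp_assoc D1 D2.
  have [|u [Eu _]] := proj2 Hk L (r1 ∘ l).
    rewrite (precomp (proj1 HR)) -comp_assoc; apply: zero_map_comp_l; by case: Hl.
  apply: zero_map_unique; rewrite -comp_assoc.
    by rewrite -Eu comp_assoc; apply: zero_map_comp_r.
  by apply: zero_map_comp_l; case: Hl.
have [t [[T1 T2] _]] := proj2 HR T a b Eab.
by rewrite -T1 -T2 !comp_assoc Er.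
Qed.

(* The triples (a, b, g) are the elements of the pullback of the kernel pairs of
   u2 and u1 over U; those with the required w form a subobject containing all
   (b, b, g) and all (a, 0, 0): a section and the kernel of (a, b, g) |-> (b, g). *)
Lemma relation_difunctional {X Y U T : C} (u1 : hom U X) (u2 : hom U Y)
    (a b g : hom T U) :
  (forall Z (x y : hom Z U), u1 ∘ x = u1 ∘ y -> u2 ∘ x = u2 ∘ y -> x = y) ->
  u2 ∘ a = u2 ∘ b -> u1 ∘ b = u1 ∘ g ->
  exists w : hom T U, u1 ∘ w = u1 ∘ a /\ u2 ∘ w = u2 ∘ g.
Proof.
move=> HU Eab Ebg.
have [R [al [be HR]]] := semi_abelian_pullbacks _ _ _ u2 u2.
have [S [be' [ga HS]]] := semi_abelian_pullbacks _ _ _ u1 u1.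
have [D [r [p HD]]] := semi_abelian_pullbacks _ _ _ be be'.
have [dR [[DR1 DR2] _]] := proj2 HR U (idm U) (idm U) eq_refl.
have [s [[S1 S2] _]] := proj2 HD S (dR ∘ be') (idm S)
  ltac:(by rewrite comp_assoc DR2 comp_idl comp_idr).
have [P [p1 [p2 HP]]] := products_exist X Y.
have [u [[V1 V2] _]] := HP U u1 u2.
have Hu : is_mono C u.
  by move=> Z x y E; apply: HU; rewrite -?V1 -?V2 -!comp_assoc E.
have [v [[W1 W2] _]] := HP D (u1 ∘ (al ∘ r)) (u2 ∘ (ga ∘ p)).
(* A point of [E] is a triple together with its [w], given by [n]. For (b, b, g) one takes w = g,
   for (a, 0, 0) one takes w = a. *)
have [E [m [n HE]]] := semi_abelian_pullbacks _ _ _ v u.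
have Hm : is_mono C m.
  move=> Z x y Exy; apply: (pullback_ext _ _ _ _ _ _ HE) => //.
  by apply: Hu; rewrite -!(precomp_square (proj1 HE)) Exy.
have factor : forall Z (x : hom Z D) (w : hom Z U),
    u1 ∘ w = u1 ∘ (al ∘ (r ∘ x)) -> u2 ∘ w = u2 ∘ (ga ∘ (p ∘ x)) ->
    exists y, m ∘ y = x.
  move=> Z x w E1 E2; have [|y [[Ey _] _]] := proj2 HE Z x w; last by exists y.
  apply: (product_ext _ _ _ _ HP).
    by chain W1; chain V1.
  by chain W2; chain V2.
have [K [k Hk]] := kernels_exist p.
have [s' Es'] : exists y, m ∘ y = s.
  apply: (factor _ _ ga); rewrite ?S1 ?S2 ?comp_idr //.
  by rewrite (precomp DR1) comp_idl (proj1 HS).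
have [k' Ek'] : exists y, m ∘ y = k.
  apply: (factor _ _ (al ∘ (r ∘ k))) => //.
  rewrite (precomp_square (proj1 HR)) (precomp_square (proj1 HD)).
  by apply: zero_map_unique; do 2!apply: zero_map_comp_l; case: Hk.
have [m' Em'] := split_mono_iso m p s k s' k' Hm S2 Hk Es' Ek'.
have [x [[X1 X2] _]] := proj2 HR T a b Eab.
have [y [[Y1 Y2] _]] := proj2 HS T b g Ebg.
have [|z [[Z1 Z2] _]] := proj2 HD T x y; first by rewrite X2 Y1.
have Evz : u ∘ (n ∘ (m' ∘ z)) = v ∘ z.
  by rewrite -(precomp_square (proj1 HE)); chain Em'.
exists (n ∘ (m' ∘ z)); split.
  by rewrite -[in LHS]V1 -comp_assoc Evz (precomp W1); assoc; rewrite Z1 X1.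
by rewrite -[in LHS]V2 -comp_assoc Evz (precomp W2); assoc; rewrite Z2 Y2.
Qed.

(** The kernel pair of [g] has a direct image along [c] that is an equivalence relation, effective
    by exactness; [i] is its class of zero. *)
Lemma regular_image_normal {S P K A I : C} (g : hom S P) (k : hom K S)
    (c : hom S A) (e : hom K I) (i : hom I A) :
  is_kernel C g k -> is_regular_epi C c -> is_regular_epi C e ->
  is_mono C i -> i ∘ e = c ∘ k ->
  exists (Q : C) (q : hom A Q), is_regular_epi C q /\ is_kernel C q i.
Proof.
move=> Hk Hc He Hi Eie.
have HP := semi_abelian_pointed.
have [R [r1 [r2 HR]]] := semi_abelian_pullbacks _ _ _ g g.
have [d [[D1 D2] _]] := proj2 HR S (idm S) (idm S) eq_refl.
have [A2 [a1 [a2 HA2]]] := products_exist A A.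
have [cc [[CC1 CC2] _]] := HA2 R (c ∘ r1) (c ∘ r2).
have [W [ew [w [Hew [Hw Ew]]]]] := image_exists cc.
have lift : forall T (x y : hom T S), g ∘ x = g ∘ y ->
    exists t : hom T W, a1 ∘ (w ∘ t) = c ∘ x /\ a2 ∘ (w ∘ t) = c ∘ y.
  move=> T x y Exy; have [t [[T1 T2] _]] := proj2 HR T x y Exy.
  exists (ew ∘ t); rewrite (precomp Ew) (precomp CC1) (precomp CC2).
  by rewrite -!comp_assoc T1 T2.
have Wmono : forall Z (x y : hom Z W),
    a1 ∘ w ∘ x = a1 ∘ w ∘ y -> a2 ∘ w ∘ x = a2 ∘ w ∘ y -> x = y.
  move=> Z x y E1 E2; apply: Hw; apply: (product_ext _ _ _ _ HA2).
    by rewrite !comp_assoc.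
  by rewrite !comp_assoc.
have [dW EdW] : exists dW : hom A W, a1 ∘ w ∘ dW = idm A /\ a2 ∘ w ∘ dW = idm A.
  (* Reflexivity: the diagonal of [A] lies in [W] after composition with [c], hence already before,
     [c] being a regular epimorphism. *)
  have [t [T1 T2]] := lift S (idm S) (idm S) eq_refl.
  have [dA [[DA1 DA2] _]] := HA2 A (idm A) (idm A).
  have [|z Ez] := regular_epi_strong c w t dA Hc Hw.
    apply: (product_ext _ _ _ _ HA2).
      by rewrite T1 (precomp DA1); assoc.
    by rewrite T2 (precomp DA2); assoc.
  by exists z; rewrite -!comp_assoc Ez.
have Wdif := fun T (x y z : hom T W) =>
  relation_difunctional (a1 ∘ w) (a2 ∘ w) x y z Wmono.
have dW1 : forall T (x : hom T A), a1 ∘ w ∘ (dW ∘ x) = x.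
  by move=> T x; rewrite (precomp (proj1 EdW)) comp_idl.
have dW2 : forall T (x : hom T A), a2 ∘ w ∘ (dW ∘ x) = x.
  by move=> T x; rewrite (precomp (proj2 EdW)) comp_idl.
(* W is the direct image of the kernel pair of g along c. *)
have HW : is_equivalence_relation C (a1 ∘ w) (a2 ∘ w).
  split; first exact: Wmono.
  split; first by exists dW.
  split.
    (* Difunctionality gives symmetry from (y, y), (x, y), (x, x), and transitivity from (x, y), (y,
       y), (y, z). *)
    have [||x [X1 X2]] := Wdif W (dW ∘ (a2 ∘ w)) (idm W) (dW ∘ (a1 ∘ w)).
      by rewrite dW2 comp_idr.
      by rewrite dW1 comp_idr.
    by exists x; rewrite X1 X2 dW1 dW2.
  move=> T x y [Exy _].
  have [||z [Z1 Z2]] := Wdif T x (dW ∘ (a2 ∘ w ∘ x)) y.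
    by rewrite dW2.
    by rewrite dW1.
  by exists z.
have [Q0 [f Hf]] : exists (Y : C) (f : hom A Y), is_kernel_pair C f (a1 ∘ w) (a2 ∘ w).
  by case: HC => _ [_ [[_ H] _]]; apply: H.
have [Q [q Hq]] : exists (Q : C) (q : hom A Q), is_coequalizer C (a1 ∘ w) (a2 ∘ w) q.
  by case: HC => _ [_ [[[_ [H _]] _] _]]; apply: H Hf.
have Hqreg : is_regular_epi C q by exists W, (a1 ∘ w), (a2 ∘ w).
(* As [f] factors through [q], pairs identified by [q] lie in the kernel pair [W] of [f]. *)
have [f' [Ef _]] := proj2 Hq _ f (proj1 Hf).
have qW : forall T (x y : hom T A), q ∘ x = q ∘ y ->
    exists t : hom T W, a1 ∘ w ∘ t = x /\ a2 ∘ w ∘ t = y.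
  move=> T x y Exy; have [|t [Et _]] := proj2 Hf T x y; last by exists t.
  by rewrite -Ef -!comp_assoc Exy.
exists Q, q; split => //; split.
  apply: (epi_zero_map _ e HP (regular_epi_epi _ He)); rewrite -comp_assoc Eie.
  have [z Hz] := zero_map_exists K S.
  have [|t [T1 T2]] := lift K k z.
    apply: zero_map_unique; first by case: Hk.
    exact: zero_map_comp_l.
  rewrite -T1 (comp_assoc _ _ _ _ _ a1) comp_assoc (proj1 Hq) -!comp_assoc T2.
  by do 2!apply: zero_map_comp_l.
have suff_lift : forall T (a : hom T A), is_zero_map C (q ∘ a) -> exists u, i ∘ u = a.
  move=> T a Ha.
  have [z Hz] := zero_map_exists T A; have [zS HzS] := zero_map_exists T S.
  have [|t [T1 T2]] := qW T a z.
    by apply: zero_map_unique => //; apply: zero_map_comp_l.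
  have [T' [p [r [Hp Er]]]] := regular_epi_lift ew t Hew.
  have Er1 : c ∘ (r1 ∘ r) = a ∘ p.
    by rewrite -T1 -comp_assoc -Er -comp_assoc (precomp Ew) (precomp CC1) comp_assoc.
  have Er2 : is_zero_map C (c ∘ (r2 ∘ r)).
    have -> : c ∘ (r2 ∘ r) = z ∘ p.
      by rewrite -T2 -comp_assoc -Er -comp_assoc (precomp Ew) (precomp CC2) comp_assoc.
    exact: zero_map_comp_r.
  (* Let V be the image of (c r1, r2) : R -> A x S.  From (a, s), (0, s), (0, 0)
     in V, where s = r2 r, difunctionality gives (a, 0) in V. *)
  have [AS [b1 [b2 HAS]]] := products_exist A S.
  have [cs [[CS1 CS2] _]] := HAS R (c ∘ r1) r2.
  have [V [ev [v [Hev [Hv Ev]]]]] := image_exists cs.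
  have liftV : forall (x : hom T' R),
      b1 ∘ v ∘ (ev ∘ x) = c ∘ (r1 ∘ x) /\ b2 ∘ v ∘ (ev ∘ x) = r2 ∘ x.
    move=> x; rewrite -!comp_assoc (precomp Ev) (precomp CS1) (precomp CS2).
    by rewrite comp_assoc.
  have [L1 L2] := liftV r.
  have [M1 M2] := liftV (d ∘ (r2 ∘ r)).
  have [N1 N2] := liftV (d ∘ (zS ∘ p)).
  have [|||y [Y1 Y2]] := relation_difunctional (b1 ∘ v) (b2 ∘ v)
      (ev ∘ r) (ev ∘ (d ∘ (r2 ∘ r))) (ev ∘ (d ∘ (zS ∘ p))).
    move=> Z x y E1 E2; apply: Hv; apply: (product_ext _ _ _ _ HAS).
      by rewrite !comp_assoc.
    by rewrite !comp_assoc.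
    by rewrite L2 M2 (precomp D2) comp_idl.
    rewrite M1 N1 !(precomp D1) !comp_idl; apply: zero_map_unique => //.
    by apply: zero_map_comp_l; apply: zero_map_comp_r.
  rewrite L1 in Y1; rewrite N2 (precomp D2) comp_idl in Y2.
  (* The lift [r'] has second component zero, so its first component lies in the kernel of [g]. Thus
     [a] factors through [i] over two covers, which are then removed in turn. *)
  have [T'' [p' [r' [Hp' Er']]]] := regular_epi_lift ev y Hev.
  have Ec : c ∘ (r1 ∘ r') = a ∘ (p ∘ p').
    rewrite comp_assoc -CS1 -comp_assoc -(precomp Ev) Er' !comp_assoc Y1.
    by rewrite Er1.
  have Hr2 : is_zero_map C (r2 ∘ r').
    rewrite -CS2 -comp_assoc -Ev -comp_assoc Er' !comp_assoc Y2.
    by do 2!apply: zero_map_comp_r.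
  have [|n [En _]] := proj2 Hk T'' (r1 ∘ r').
    by rewrite (precomp_square (proj1 HR)); apply: zero_map_comp_l.
  have [|u1 Eu1] := regular_epi_strong p' i (e ∘ n) (a ∘ p) Hp' Hi.
    by rewrite (precomp Eie) -comp_assoc En Ec comp_assoc.
  exact: (regular_epi_strong p i u1 a Hp Hi Eu1).
move=> T a /suff_lift [u Eu]; exists u; split => // v Ev.
by apply: Hi; rewrite Eu.
Qed.

(** * The quotient by the commutator *)

Lemma coproduct_to_product_regular_epi {X Y S P : C} (i1 : hom X S) (i2 : hom Y S)
    (p1 : hom P X) (p2 : hom P Y) (e1 : hom X P) (e2 : hom Y P) (Sigma : hom S P) :
  is_product_inj p1 p2 e1 e2 -> Sigma ∘ i1 = e1 -> Sigma ∘ i2 = e2 ->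
  is_regular_epi C Sigma.
Proof.
move=> HP E1 E2; apply: extremal_regular_epi => I e m Hm E.
(* A subobject through which [Sigma] factors contains both injections: the kernel [e1] of [p2] and
   its section [e2]. *)
apply: (split_mono_iso m p2 e2 e1 (e ∘ i2) (e ∘ i1) Hm).
- by case: HP => _ [_ [_ [_ ?]]].
- exact: product_inj_kernel HP.
- by rewrite comp_assoc E.
- by rewrite comp_assoc E.
Qed.

Lemma commutator_quotient {X Y S P K J H : C} (i1 : hom X S) (i2 : hom Y S)
    (p1 : hom P X) (p2 : hom P Y) (e1 : hom X P) (e2 : hom Y P)
    (Sigma : hom S P) (k : hom K S) (c : hom S J) (e : hom K H) (h : hom H J) :
  is_product_inj p1 p2 e1 e2 -> Sigma ∘ i1 = e1 -> Sigma ∘ i2 = e2 ->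
  is_kernel C Sigma k -> is_regular_epi C c ->
  is_regular_epi C e -> is_mono C h -> h ∘ e = c ∘ k ->
  exists (Q : C) (q : hom J Q) (phi : hom P Q),
    is_regular_epi C q /\ is_kernel C q h /\ is_regular_epi C phi /\
    phi ∘ e1 = q ∘ (c ∘ i1) /\ phi ∘ e2 = q ∘ (c ∘ i2).
Proof.
move=> HP E1 E2 Hk Hc He Hh Ehe.
have [Q [q [Hq Hqh]]] := regular_image_normal Sigma k c e h Hk Hc He Hh Ehe.
have HSigma := coproduct_to_product_regular_epi i1 i2 _ _ _ _ Sigma HP E1 E2.
have [|phi Ephi] := regular_epi_cokernel Sigma k (q ∘ c) HSigma Hk.
  rewrite -comp_assoc -Ehe comp_assoc; apply: zero_map_comp_r; by case: Hqh.
exists Q, q, phi; do 2!split => //; split; last first.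
  by rewrite -E1 -E2 !comp_assoc Ephi.
(* A monomorphism through which [phi] factors also admits q ∘ c, hence [q], hence the identity of
   [Q]. *)
apply: extremal_regular_epi => I d m Hm E.
have [|z Ez] := regular_epi_strong c m (d ∘ Sigma) q Hc Hm.
  by rewrite comp_assoc E.
by apply: (regular_epi_strong q m z (idm Q) Hq Hm); rewrite comp_idl.
Qed.

Lemma higgins_commutator_exists (A : C) :
  exists H : subobj C A, is_higgins_commutator C (top_sub C A) (top_sub C A) H.
Proof.
have HS : has_binary_coproducts C by case: HC => _ [_ [_ [_ ?]]].
have [S [i1 [i2 HSi]]] := HS A A.
have [P [p1 [p2 [e1 [e2 [HP HE]]]]]] := product_inj_exists A A.
have [Sigma [[E1 E2] _]] := HSi P e1 e2.
have [K [k Hk]] := kernels_exist Sigma.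
have [c [[C1 C2] _]] := HSi A (idm A) (idm A).
have [I [e [m [He [Hm Em]]]]] := image_exists (c ∘ k).
exists (Subobj m), S, i1, i2, P, p1, p2, Sigma, K, k, c.
rewrite E1 E2; case: HE => [F1 [F2 [F3 F4]]].
by do !split => //; exists e.
Qed.

(** * Perfectness and the three equivalent conditions *)

Lemma perfect_commute_zero {A Q : C} (f : hom A Q) :
  all_perfect C -> commute f f -> is_zero_map C f.
Proof.
move=> Hperf [P [p1 [p2 [e1 [e2 [phi [HP [F1 F2]]]]]]]].
have [H HH] := higgins_commutator_exists A.
have [_ [u Eu]] := Hperf A H HH.
move: HH => [S [i1 [i2 [P' [p1' [p2' [Sigma [K [k [c [HS [HP' [E1 [E2 [E3 [E4
  [Hk [C1 [C2 [_ [e [He Ee]]]]]]]]]]]]]]]]]]]]]].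
have HPI : is_product_inj p1' p2' (Sigma ∘ i1) (Sigma ∘ i2) by [].
have [v [_ [_ [V1 V2]]]] :=
  product_inj_pair_comp _ _ _ _ p1 p2 e1 e2 (idm A) (idm A) HPI HP.
(* Here [c] is the codiagonal. This factorization makes [f] vanish on the image of the cosmash
   product, which is [A,A] = A. *)
have Efc : f ∘ c = phi ∘ v ∘ Sigma.
  apply: (coproduct_ext _ _ _ _ HS).
    by rewrite -!comp_assoc V1 C1 (precomp F1).
  by rewrite -!comp_assoc V2 C2 (precomp F2).
have HfH : is_zero_map C (f ∘ sarr H).
  apply: (epi_zero_map _ e semi_abelian_pointed (regular_epi_epi _ He)).
  rewrite -comp_assoc Ee comp_assoc Efc -comp_assoc.
  by apply: zero_map_comp_l; case: Hk.
by rewrite -(comp_idr _ _ _ f) -[idm A]Eu comp_assoc; apply: zero_map_comp_r.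
Qed.

Lemma perfect_no_abelian : all_perfect C -> only_abelian_is_zero C.
Proof.
move=> Hperf A /commute_id_abelian HA; apply: zero_id_zero_obj.
exact: perfect_commute_zero.
Qed.

Lemma no_abelian_perfect : only_abelian_is_zero C -> all_perfect C.
Proof.
move=> Hab A H [S [i1 [i2 [P [p1 [p2 [Sigma [K [k [c [HS [HP [E1 [E2 [E3 [E4
  [Hk [C1 [C2 [HH [e [He Ee]]]]]]]]]]]]]]]]]]]]]].
have HPI : is_product_inj p1 p2 (Sigma ∘ i1) (Sigma ∘ i2) by [].
have Hc : is_regular_epi C c.
  (* The codiagonal [c] is split by [i1]. *)
  apply: extremal_regular_epi => I d m Hm E; exists (d ∘ i1).
  by rewrite comp_assoc E.
have [Q [q [phi [Hq [Hqh [_ [F1 F2]]]]]]] :=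
  commutator_quotient i1 i2 _ _ _ _ Sigma k c e _ HPI eq_refl eq_refl Hk Hc He HH Ee.
have Hqq : commute (idm Q ∘ q) (idm Q ∘ q).
  exists P, p1, p2, (Sigma ∘ i1), (Sigma ∘ i2), phi; split => //.
  by rewrite F1 F2 C1 C2 comp_idl comp_idr.
have HQ : is_zero_obj C Q.
  by apply: Hab; apply/commute_id_abelian; apply: commute_regular_epi Hqq.
split; first by exists (sarr H); rewrite /= comp_idl.
have [|u [Eu _]] := proj2 Hqh A (idm A); last by exists u.
exact: zero_obj_zero_map.
Qed.

(** For X = Y = A, the join, both normal closures and their meet are all [A]; it is normal as the
    kernel of the map to a zero object. *)
Lemma higgins_meet_perfect : higgins_is_meet_of_normal_closures C -> all_perfect C.
Proof.
move=> Hmeet A H HH.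
have top_max (B : C) (N : subobj C B) : sub_le C N (top_sub C B).
  by exists (sarr N); rewrite /= comp_idl.
have top_sub_mono (B : C) : is_subobj C (top_sub C B).
  by move=> Z g h /=; rewrite !comp_idl.
have push_top : push_sub C (top_sub C A) (top_sub C A) = top_sub C A.
  by rewrite /push_sub /= comp_idl.
have top_join : is_join C (top_sub C A) (top_sub C A) (top_sub C A).
  by do !split.
have top_normal : is_normal C (top_sub C A).
  have [O HO] := semi_abelian_pointed; have [z _] := proj2 HO A.
  exists O, z; split; first exact: zero_obj_zero_map.
  move=> Z h _; exists h; split => [|u] /=; first by rewrite comp_idl.
  by rewrite comp_idl => ->.
have top_closure : is_normal_closure C (top_sub C A) (top_sub C A) (top_sub C A).
  do 2!split => //; split; first by rewrite push_top.
  by move=> N' _ _; rewrite /push_sub /= => -[u Eu]; exists u; rewrite -[RHS]Eu comp_idl.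
apply: (Hmeet _ _ _ _ _ _ _ _ _ _ top_join top_closure top_closure) => //.
by rewrite push_top; do !split.
Qed.

Lemma perfect_higgins_meet : all_perfect C -> higgins_is_meet_of_normal_closures C.
Proof.
move=> Hperf A X Y HX HY J NX NY M H HJ HNX HNY HM HH.
move: HH => [S [i1 [i2 [P [p1 [p2 [Sigma [K [k [cA [HS [HP [E1 [E2 [E3 [E4
  [Hk [C1 [C2 [HH [e [He Ee]]]]]]]]]]]]]]]]]]]]]].
have HPI : is_product_inj p1 p2 (Sigma ∘ i1) (Sigma ∘ i2) by [].
have [Jm [[x Ex] [[y Ey] Jmin]]] := HJ.
have [c [[Cx Cy] _]] := HS _ x y.
have Ec : sarr J ∘ c = cA.
  by apply: (coproduct_ext _ _ _ _ HS); rewrite -comp_assoc ?Cx ?Cy ?C1 ?C2.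
have Hc : is_regular_epi C c.
  (* A subobject of [J] through which [c] factors contains [X] and [Y], so by minimality of the join
     it is all of [J]. *)
  apply: extremal_regular_epi => I d m Hm E.
  have [|||s Es] := Jmin (Subobj (sarr J ∘ m)).
    by move=> Z a b /=; rewrite -!comp_assoc => /Jm /Hm.
    by exists (d ∘ i1) => /=; rewrite -comp_assoc (precomp E) Cx.
    by exists (d ∘ i2) => /=; rewrite -comp_assoc (precomp E) Cy.
  by exists s; apply: Jm; rewrite comp_assoc comp_idr.
have [NXm [[DX [fX HfX]] [[tx Etx] NXmin]]] := HNX.
have [NYm [[DY [fY HfY]] [[ty Ety] NYmin]]] := HNY.
have {}Etx : sarr NX ∘ tx = x by apply: Jm; rewrite comp_assoc Ex.
have {}Ety : sarr NY ∘ ty = y by apply: Jm; rewrite comp_assoc Ey.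
(* Modulo [NX] the map [x] vanishes, so fX ∘ c depends only on the second component and factors
   through [Sigma], whose kernel it therefore kills. *)
have ckX : exists n, sarr NX ∘ n = c ∘ k.
  have Ef : fX ∘ c = fX ∘ y ∘ p2 ∘ Sigma.
    apply: (coproduct_ext _ _ _ _ HS).
      apply: zero_map_unique; last first.
        by rewrite -!comp_assoc; do 2!apply: zero_map_comp_l.
      rewrite -comp_assoc Cx -Etx comp_assoc; apply: zero_map_comp_r.
      by case: HfX.
    by rewrite -!comp_assoc E4 Cy comp_idr.
  have [|n [En _]] := proj2 HfX K (c ∘ k); last by exists n.
  rewrite comp_assoc Ef -comp_assoc; apply: zero_map_comp_l; by case: Hk.
have ckY : exists n, sarr NY ∘ n = c ∘ k.
  have Ef : fY ∘ c = fY ∘ x ∘ p1 ∘ Sigma.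
    apply: (coproduct_ext _ _ _ _ HS).
      by rewrite -!comp_assoc E1 Cx comp_idr.
    apply: zero_map_unique; last first.
      by rewrite -!comp_assoc; do 2!apply: zero_map_comp_l.
    rewrite -comp_assoc Cy -Ety comp_assoc; apply: zero_map_comp_r.
    by case: HfY.
  have [|n [En _]] := proj2 HfY K (c ∘ k); last by exists n.
  rewrite comp_assoc Ef -comp_assoc; apply: zero_map_comp_l; by case: Hk.
have Hle : forall N : subobj C (sob J), is_subobj C N ->
    (exists n, sarr N ∘ n = c ∘ k) -> sub_le C H (push_sub C J N).
  move=> N HN [n En].
  apply: (regular_epi_strong e _ n (sarr H) He).
    by move=> Z a b /=; rewrite -!comp_assoc => /Jm /HN.
  by rewrite /= -comp_assoc En Ee comp_assoc Ec.
have [Mm [[a Ea] [[b Eb] Mmax]]] := HM.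
split; first by apply: Mmax => //; apply: Hle.
move: Ea Eb; rewrite /= -!comp_assoc => Ea Eb.
have Eab : sarr NX ∘ a = sarr NY ∘ b by apply: Jm; rewrite Ea Eb.
have [h0 Eh0] := Hle _ NXm ckX.
move: Eh0; rewrite /= -comp_assoc; move: (sarr NX ∘ h0) => h Eh.
have Hh : is_mono C h.
  by move=> Z u v E; apply: HH; rewrite -Eh -!comp_assoc E.
have Ehe : h ∘ e = c ∘ k.
  by apply: Jm; rewrite comp_assoc Eh Ee comp_assoc Ec.
have [Q [q [phi [Hq [Hqh [Hphi [F1 F2]]]]]]] :=
  commutator_quotient i1 i2 _ _ _ _ Sigma k c e h HPI eq_refl eq_refl Hk Hc He Hh Ehe.
have [IX [eX [mX [HeX [HmX EmX]]]]] := image_exists (phi ∘ (Sigma ∘ i1)).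
have [IY [eY [mY [HeY [HmY EmY]]]]] := image_exists (phi ∘ (Sigma ∘ i2)).
(* Both product injections are kernels, so their images under the regular epimorphism [phi] are
   normal in [Q]. *)
have [GX [gX [_ HgX]]] := regular_image_normal p2 (Sigma ∘ i1) phi eX mX
  (product_inj_kernel _ _ _ _ HPI) Hphi HeX HmX EmX.
have [GY [gY [_ HgY]]] := regular_image_normal p1 (Sigma ∘ i2) phi eY mY
  (product_inj_kernel _ _ _ _ (product_inj_sym _ _ _ _ HPI)) Hphi HeY HmY EmY.
have Hcomm : commute mX mY.
  apply: (commute_regular_epi _ _ eX eY HeX HeY); rewrite EmX EmY.
  by exists P, p1, p2, (Sigma ∘ i1), (Sigma ∘ i2), phi.
(* The inverse image along [q] of a normal subobject is normal, as the kernel of g ∘ q; if it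
   contains [Z], it contains the normal closure. *)
have closure_image : forall (Z I G : C) (N : subobj C (sob J)) (z : hom Z (sob J))
    (d : hom Z I) (m : hom I Q) (g : hom Q G),
    (forall N' : subobj C (sob J), is_subobj C N' -> is_normal C N' ->
       (exists t, sarr N' ∘ t = z) -> sub_le C N N') ->
    m ∘ d = q ∘ z -> is_kernel C g m ->
    exists t, m ∘ t = q ∘ sarr N.
  move=> Z I G N z d m g Nmin Ed Hg.
  have [L [l Hl]] := kernels_exist (g ∘ q).
  have [|||n En] := Nmin (Subobj l).
    exact: kernel_mono Hl.
    by exists G, (g ∘ q).
    have [|t [Et _]] := proj2 Hl Z z; last by exists t.
    by rewrite -comp_assoc -Ed comp_assoc; apply: zero_map_comp_r; case: Hg.
  have [|t [Et _]] := proj2 Hg _ (q ∘ sarr N); last by exists t.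
  rewrite comp_assoc -En comp_assoc; apply: zero_map_comp_r; by case: Hl.
have [sX EsX] : exists t, mX ∘ t = q ∘ sarr NX.
  apply: (closure_image _ _ _ _ x eX mX gX _ _ HgX); last by rewrite EmX F1 Cx.
  move=> N' HN' HnN' [t Et]; apply: NXmin => //.
  by exists t; rewrite /= -comp_assoc Et.
have [sY EsY] : exists t, mY ∘ t = q ∘ sarr NY.
  apply: (closure_image _ _ _ _ y eY mY gY _ _ HgY); last by rewrite EmY F2 Cy.
  move=> N' HN' HnN' [t Et]; apply: NYmin => //.
  by exists t; rewrite /= -comp_assoc Et.
(* On the meet, the maps into [Q] through [mX] and [mY] coincide, so this single map commutes with
   itself. *)
have Hzero : is_zero_map C (q ∘ (sarr NX ∘ a)).
  apply: perfect_commute_zero => //.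
  have := commute_comp mX mY (sX ∘ a) (sY ∘ b) Hcomm.
  by rewrite (precomp EsX) (precomp EsY) -!comp_assoc -Eab.
have [u [Eu _]] := proj2 Hqh _ _ Hzero.
by exists u; rewrite -Ea -Eu comp_assoc Eh.
Qed.

End SemiAbelian.

Theorem mainTheorem7 (C : Cat) (HC : semi_abelian C) :
  (only_abelian_is_zero C <-> higgins_is_meet_of_normal_closures C) /\
  (higgins_is_meet_of_normal_closures C <-> all_perfect C).
Proof.
have P := perfect_no_abelian HC; have Q := no_abelian_perfect HC.
have R := higgins_meet_perfect HC; have S := perfect_higgins_meet HC.
by split; split; auto.
Qed.
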